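(* Let $G$ be a directed graph, finite or infinite, which is a retract of a product $\prod_{i\in I}L_i$ of reflexive oriented zigzags $L_i$ of bounded length (i.e. there is an integer $n$ such that every $L_i$ has length at most $n$). Then every commuting set of endomorphisms of $G$ has a common fixed point.
   Context: A directed graph is a pair $G=(E,\mathcal E)$ with $\mathcal E\subseteq E\times E$; it is reflexive if $(x,x)\in\mathcal E$ for all $x$, and oriented if $\mathcal E$ is antisymmetric ($(x,y),(y,x)\in\mathcal E$ implies $x=y$). A homomorphism from $(E,\mathcal E)$ to $(E',\mathcal E')$ is a map $h:E\to E'$ with $(h(x),h(y))\in\mathcal E'$ whenever $(x,y)\in\mathcal E$; an endomorphism of $G$ is a homomorphism from $G$ to $G$. The product $\prod_{i\in I}G_i$ of directed graphs $G_i=(E_i,\mathcal E_i)$ has vertex set $\prod_i E_i$ and edges the pairs $((x_i)_i,(y_i)_i)$ with $(x_i,y_i)\in\mathcal E_i$ for all $i$. $G$ is a retract of $H$ if there are homomorphisms $f:G\to H$ and $g:H\to G$ with $g\circ f=\mathrm{id}_G$. A reflexive oriented zigzag is a finite reflexive oriented graph on vertices that can be enumerated without repetition as $v_0,\dots,v_n$ ($n\ge 0$) so that, for each $i<n$, exactly one of $(v_i,v_{i+1})$, $(v_{i+1},v_i)$ is an edge, and there are no other edges except the loops; its length is $n$. *)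

(* Defs.v *)
From Stdlib Require Import Relation_Definitions.
From mathcomp Require Import all_boot.
From mathcomp Require Import boolp classical_sets.

Set Implicit Arguments.
Unset Strict Implicit.
Unset Printing Implicit Defensive.

Record digraph := Digraph {
  vertex :> Type;
  edge : vertex -> vertex -> Prop
}.

Arguments edge {d} _ _.

Definition reflexive_digraph (G : digraph) : Prop :=
  Relation_Definitions.reflexive G edge.

Definition oriented_digraph (G : digraph) : Prop :=
  Relation_Definitions.antisymmetric G edge.

Definition digraph_hom (G H : digraph) (h : G -> H) : Prop :=
  forall x y : G, edge x y -> edge (h x) (h y).

Definition digraph_endo (G : digraph) (h : G -> G) : Prop := digraph_hom h.

Definition digraph_prod (I : Type) (L : I -> digraph) : digraph :=
  {| vertex := forall i : I, L i;
     edge := fun x y => forall i : I, edge (x i) (y i) |}.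

Definition digraph_retract (G H : digraph) : Prop :=
  exists (f : G -> H) (g : H -> G),
    [/\ digraph_hom f, digraph_hom g & forall x : G, g (f x) = x].

(* A zigzag of length [n] has [n.+1] vertices; its finiteness is carried by
   the bijective enumeration [v]. *)
Definition zigzag_enum (G : digraph) (n : nat) (v : 'I_n.+1 -> G) : Prop :=
  [/\ bijective v,
      forall i j : 'I_n.+1, j = i.+1 :> nat ->
        (edge (v i) (v j) /\ ~ edge (v j) (v i)) \/
        (edge (v j) (v i) /\ ~ edge (v i) (v j))
    & forall i j : 'I_n.+1, edge (v i) (v j) ->
        [\/ i = j, j = i.+1 :> nat | i = j.+1 :> nat]].

Definition reflexive_oriented_zigzag (G : digraph) (n : nat) : Prop :=
  [/\ reflexive_digraph G, oriented_digraph G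
    & exists v : 'I_n.+1 -> G, zigzag_enum v].

Definition commuting_set (T : Type) (F : set (T -> T)) : Prop :=
  forall f g : T -> T, F f -> F g -> forall x : T, f (g x) = g (f x).

(* Main.v *)
(* Conjugating by the retraction reduces to [G] being the product itself.
   Measure distances by alternating walks, [zigzag b k]: in a zigzag their balls
   are intervals, so in the product any pairwise meeting balls have a common
   point.  Call a set [H] hyperconvex if pairwise meeting balls centred in [H]
   meet in [H].  Hyperconvexity passes from an invariant [H] to the fixed
   points of an endomorphism in [H] (a minimal invariant admissible set equals
   its center, hence is a point), and to intersections of chains.  By Zorn there
   is a minimal hyperconvex set invariant under all the commuting maps;
   minimality forces it to consist of common fixed points. *)
Require Import Defs.
From mathcomp Require Import all_boot.
From mathcomp Require Import zify.
From mathcomp Require Import boolp classical_sets.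

Set Implicit Arguments.
Unset Strict Implicit.
Unset Printing Implicit Defensive.

Local Open Scope classical_set_scope.

(** * Minimal sets from Zorn's lemma *)

(** Only nonempty chains need their intersection in [Q]: the empty chain is bounded by the given
    member. *)
Lemma exists_minimal_set (U : Type) (Q : set (set U)) :
  (exists X, Q X) ->
  (forall D : set (set U), D !=set0 -> D `<=` Q ->
     total_on D subset -> Q (\bigcap_(X in D) X)) ->
  exists M, Q M /\ forall N, Q N -> N `<=` M -> M `<=` N.
Proof.
move=> [X0 QX0] Qcap.
pose R (X Y : {X | Q X}) := `[< sval Y `<=` sval X >].
have [||D totD|[M QM] Mmax] := @ZL_preorder _ (exist _ X0 QX0) R.
- by move=> X; apply/asboolP.
- by move=> X Y Z /asboolP XY /asboolP YZ; apply/asboolP => x /YZ /XY.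
- have [D0|D0] := pselect (D !=set0); last first.
    by exists (exist _ X0 QX0) => X DX; case: D0; exists X.
  have QD : Q (\bigcap_(X in [set sval X | X in D]) X).
    apply: Qcap; first by have [X DX] := D0; exists (sval X); exists X.
      by move=> _ [X _ <-]; exact: (svalP X).
    move=> _ _ [X DX <-] [Y DY <-].
    by have [/asboolP|/asboolP] := totD _ _ DX DY; [right|left].
  exists (exist _ _ QD) => X DX; apply/asboolP => x /=.
  by apply; exists X.
exists M; split=> // N QN NM.
have /(_ _)/asboolP := Mmax (exist _ N QN); apply.
exact/asboolP.
Qed.

(** * Alternating walks *)

Section Walks.
Variable G : digraph.
Implicit Types (x y z : G) (b : bool) (k l : nat).

Definition arc b x y : Prop := if b then edge x y else edge y x.

Fixpoint zigzag b k x y : Prop :=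
  if k is k'.+1 then exists2 z, arc b x z & zigzag (~~ b) k' z y else x = y.

Lemma arcC b x y : arc b x y <-> arc (~~ b) y x.
Proof. by case: b. Qed.

Lemma zigzag_cat b k l x y :
  zigzag b (k + l) x y <->
  exists2 z, zigzag b k x z & zigzag (b (+) odd k) l z y.
Proof.
elim: k b x => [|k IH] b x /=.
  rewrite add0n addbF; split=> [xy|[z -> //]].
  by exists x.
split=> [[u xu /IH[z uz zy]]|[z [u xu uz] zy]].
  exists z; first by exists u.
  by move: zy; rewrite addNb addbN.
exists u => //; apply/IH; exists z => //.
by rewrite addNb -addbN.
Qed.

Lemma zigzagSr b k x y :
  zigzag b k.+1 x y <-> exists2 z, zigzag b k x z & arc (b (+) odd k) z y.
Proof.
rewrite -addn1; split=> [/zigzag_cat[z xz /= [u zu <-]]|[z xz zy]].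
  by exists z.
by apply/zigzag_cat; exists z => //; exists y.
Qed.

(** Read backwards, a nonempty walk starts with its last arc reversed, whose direction is
    [b (+) odd k]. *)
Lemma zigzag_sym b k x y : zigzag b k x y -> zigzag (b (+) odd k) k y x.
Proof.
elim: k b x => [|k IH] b x; first by move=> /= ->.
move=> [z xz /IH zy]; apply/zigzagSr; exists z.
  by move: zy; rewrite /= addNb -addbN.
have -> : (b (+) odd k.+1) (+) odd k = ~~ b.
  by rewrite /=; case: b (odd k) {xz zy} => [] [].
by apply/arcC; rewrite negbK.
Qed.

Lemma zigzag_hom (f : G -> G) b k x y :
  digraph_endo f -> zigzag b k x y -> zigzag b k (f x) (f y).
Proof.
move=> hf; elim: k b x => [|k IH] b x /=; first by move=> ->.
by move=> [z xz /IH zy]; exists (f z) => //; case: b xz {zy} => /hf.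
Qed.

Hypothesis Grefl : reflexive_digraph G.

Lemma arc_refl b x : arc b x x.
Proof. by case: b; exact: Grefl. Qed.

Lemma zigzag_refl b k x : zigzag b k x x.
Proof. by elim: k b => //= k IH b; exists x => //; exact: arc_refl. Qed.

Lemma zigzag_leq b k l x y : k <= l -> zigzag b k x y -> zigzag b l x y.
Proof.
move=> /subnKC <- xy; apply/zigzag_cat; exists y => //; exact: zigzag_refl.
Qed.

(** Loops pad the walk to length [l + l]; it is cut in the middle, and the second half read
    backwards again starts in direction [b]. *)
Lemma zigzag_half b k l x y : k <= l + l -> zigzag b k x y ->
  exists2 z, zigzag b l x z & zigzag b l y z.
Proof.
move=> kl /(zigzag_leq kl)/zigzag_cat[z xz /zigzag_sym zy]; exists z => //.
by move: zy; rewrite -addbA addbb addbF.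
Qed.

End Walks.

(** * Balls, hyperconvexity and admissible sets *)

Definition ball (G : digraph) (B : G * (bool * nat)) : set G :=
  [set y | zigzag B.2.1 B.2.2 B.1 y].

(** Balls may meet pairwise outside [H], but the common point lies in [H]; the empty [S] makes [H]
    nonempty. *)
Definition hyperconvex (G : digraph) (H : set G) : Prop :=
  forall S : set (G * (bool * nat)),
    (forall B, S B -> H B.1) ->
    (forall B C, S B -> S C -> ball B `&` ball C !=set0) ->
    exists2 z, H z & forall B, S B -> ball B z.

(* Equivalently, [A] is the trace on [H] of an intersection of balls centred
   in [H]. *)
Definition admissible (G : digraph) (H A : set G) : Prop :=
  A `<=` H /\
  forall x, H x -> (forall B, H B.1 -> A `<=` ball B -> ball B x) -> A x.

Definition center (G : digraph) (b : bool) (l : nat) (A : set G) : set G :=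
  [set x | A x /\ forall a, A a -> zigzag b l a x].

(** * Fixed points of commuting endomorphisms *)

Section FixedPoints.
Variable G : digraph.
Hypothesis Grefl : reflexive_digraph G.
Hypothesis Gori : oriented_digraph G.
Hypothesis Gbnd : exists k, forall x y : G, zigzag true k x y.
Implicit Types (H A : set G) (x y z : G).

(** Balls centred in [H] that contain some [A i] meet pairwise, since the smaller of two members
    lies in both; a point of [H] common to all of them is in every [A i]. *)
Lemma chain_admissible_nonempty (J : Type) (D : set J) (A : J -> set G) H :
  hyperconvex H ->
  (forall i j, D i -> D j -> A i `<=` A j \/ A j `<=` A i) ->
  (forall i, D i -> admissible H (A i) /\ A i !=set0) ->
  exists z, forall i, D i -> A i z.
Proof.
move=> hH tot hA.
have [|B C [_ [i Di iB]] [_ [j Dj jC]]|z Hz zS] :=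
  hH [set B | H B.1 /\ exists2 i, D i & A i `<=` ball B].
- by move=> B [].
- have [[_ [x xi]] [_ [y yj]]] := (hA _ Di, hA _ Dj).
  by have [ij|ji] := tot _ _ Di Dj; [exists x|exists y]; split; auto.
exists z => i Di; have [[_ hi] _] := hA _ Di.
by apply: hi => // B HB iB; apply: zS; split=> //; exists i.
Qed.

Lemma admissible_bigcap (J : Type) (D : set J) (A : J -> set G) H :
  D !=set0 -> (forall i, D i -> admissible H (A i)) ->
  admissible H [set x | forall i, D i -> A i x].
Proof.
move=> [i0 Di0] hA; split=> [x /(_ _ Di0)|x Hx hx i Di].
  by case: (hA _ Di0) => h _ /h.
by case: (hA _ Di) => _; apply=> // B HB iB; apply: hx => // y /(_ _ Di)/iB.
Qed.

Lemma admissible_balls H (S : set (G * (bool * nat))) :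
  (forall B, S B -> H B.1) ->
  admissible H [set x | H x /\ forall B, S B -> ball B x].
Proof.
move=> SH; split=> [x []//|x Hx hx]; split=> // B SB.
by apply: hx => [|y [_]]; auto.
Qed.

Lemma admissible_center b l H A : admissible H A -> admissible H (center b l A).
Proof.
move=> [AH hA]; split=> [x [/AH]//|x Hx hx]; split=> [|a Aa].
  by apply: hA => // B HB AB; apply: hx => // y [/AB].
by apply: (hx (a, (b, l))) => [|y [_]]; [exact: AH|exact].
Qed.

(** Hyperconvexity is applied to the balls containing [A] together with the balls of type [(b, l)]
    around the points of [A]. *)
Lemma center_nonempty b l H A : hyperconvex H -> admissible H A -> A !=set0 ->
  (forall a c, A a -> A c -> exists2 y, zigzag b l a y & zigzag b l c y) ->
  center b l A !=set0.
Proof.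
move=> hH [AH hA] [x0 Ax0] hbl.
have [|B C|z Hz zS] := hH [set B | H B.1 /\
    (A `<=` ball B \/ exists2 a, A a & B = (a, (b, l)))].
- by move=> B [].
- move=> [_ [AB|[a Aa ->]]] [_ [AC|[c Ac ->]]].
  + by exists x0; split; auto.
  + by exists c; split; [auto|exact: zigzag_refl].
  + by exists a; split; [exact: zigzag_refl|auto].
  + by have [y ay cy] := hbl _ _ Aa Ac; exists y.
exists z; split=> [|a Aa].
  by apply: hA => // B HB AB; apply: zS; split; auto.
by apply: (zS (a, (b, l))); split=> /=; [auto|right; exists a].
Qed.

(* Take [l] minimal.  If [zigzag b l] related all points of each member, then
   halving it would contradict minimality when [l > 1], and antisymmetry
   settles [l = 1]. *)
Lemma center_radius (D : set (set G)) : exists b l,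
  (forall A, D A -> forall a c, A a -> A c ->
     exists2 y, zigzag b l a y & zigzag b l c y) /\
  ((forall A, D A -> forall a c, A a -> A c -> zigzag b l a c) ->
   forall A, D A -> forall a c, A a -> A c -> a = c).
Proof.
pose R l := exists b, forall A, D A -> forall a c, A a -> A c ->
  exists2 y, zigzag b l a y & @zigzag G b l c y.
have exR : exists l, `[< R l >].
  have [k hk] := Gbnd; exists k; apply/asboolP; exists true => A _ a c _ _.
  by exists c => //; exact: zigzag_refl.
case: (ex_minnP exR) => l /asboolP[b hb] lmin; exists b, l; split=> // hQ.
case: l => [|[|l]] in hb lmin hQ *.
- by move=> A DA a c Aa Ac; have [y /= -> ->] := hb _ DA _ _ Aa Ac.
- move=> A DA a c Aa Ac.
  have [/= z az zc] := hQ _ DA _ _ Aa Ac; have [/= u cu ua] := hQ _ DA _ _ Ac Aa.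
  by subst z u; apply: Gori; case: b {hb hQ} az cu.
suff : l.+2 <= uphalf l.+2 by lia.
apply: lmin; apply/asboolP; exists b => A DA a c Aa Ac.
by apply: (zigzag_half Grefl _ (hQ _ DA _ _ Aa Ac)); lia.
Qed.

Lemma hyperconvex_fixpoints H (f : G -> G) :
  hyperconvex H -> digraph_endo f -> (forall x, H x -> H (f x)) ->
  hyperconvex [set x | H x /\ f x = x].
Proof.
move=> hH hf fH S SH Smeet.
pose A0 := [set x | H x /\ forall B, S B -> ball B x].
pose Q A := [/\ admissible H A, A !=set0, (forall x, A x -> A (f x)) & A `<=` A0].
have [|D D0 DQ totD|A [[Aadm [x0 Ax0] fA AA0] Amin]] := @exists_minimal_set G Q.
- exists A0; split=> //.
  + by apply: admissible_balls => B /SH[].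
  + have [B /SH[]//|//|x Hx Sx] := hH S.
    by exists x.
  (* The centres of the balls in [S] are fixed, so [f] maps [A0] into itself. *)
  + move=> x [Hx Sx]; split=> [|B SB]; first exact: fH.
    have [_ fB] := SH _ SB; rewrite /ball /= -fB.
    by apply: zigzag_hom => //; exact: Sx.
- split.
  + by apply: (@admissible_bigcap _ D id) => // A /DQ[].
  + apply: (@chain_admissible_nonempty _ D id _ hH) => // A.
    by move=> /DQ[].
  + by move=> x Dx A DA; have [_ _ fA _] := DQ _ DA; apply: fA; exact: Dx.
  + by move=> x Dx; have [A DA] := D0; have [_ _ _] := DQ _ DA; apply; exact: Dx.
(* The points of [A] lying in all balls that contain the image of [A] form an invariant admissible
   set, hence all of [A]. *)
have hull B : H B.1 -> (forall a, A a -> ball B (f a)) -> A `<=` ball B.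
  move=> HB fB.
  pose A' := [set x | A x /\ forall C, H C.1 ->
    (forall a, A a -> ball C (f a)) -> ball C x].
  have A'A : A' `<=` A by move=> x [].
  have fA' x : A x -> A' (f x).
    by move=> Ax; split=> [|C _]; [exact: fA|exact].
  suff : Q A' by move=> /Amin/(_ A'A) AA' x /AA'[_]; apply.
  split; last by move=> x /A'A/AA0.
  + split=> [x /A'A|x Hx hx]; first by case: Aadm => h _ /h.
    split=> [|C HC fC]; last by apply: hx => // y [_]; apply.
    by case: Aadm => _; apply=> // C HC AC; apply: hx => // y /A'A/AC.
  + by exists (f x0); exact: fA'.
  + by move=> x /A'A/fA'.
have [b [l [hbl Qbl]]] := center_radius [set A].
have CA : center b l A `<=` A by move=> x [].
have AC : A `<=` center b l A.
  apply: Amin => //; split; last by move=> x /CA/AA0.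
  - exact: admissible_center.
  - by apply: center_nonempty hH _ _ _ => //; [exists x0|exact: hbl].
  - move=> x [Ax xA]; split=> [|a Aa]; first exact: fA.
    (* The ball of reversed type around [f x] contains the image of [A], hence [A] by [hull]. *)
    rewrite -[b](addbK (odd l)); apply: zigzag_sym.
    apply: (hull (f x, (b (+) odd l, l))) => //.
      by case: Aadm => h _; exact/h/fA.
    by move=> c Ac; apply/zigzag_sym/zigzag_hom => //; exact: xA.
have [Hx0 Sx0] := AA0 _ Ax0.
exists x0 => //; split=> //.
apply: (Qbl _ A) => //; last exact: fA.
by move=> _ -> a c Aa /AC[_]; apply.
Qed.

(* Baillon's argument: an admissible subset of [K] need not be admissible in a
   larger set of the chain, so one minimizes whole families [H |-> A_H] with
   [A_H] admissible in [H].  Minimality makes every ball centred in [A_H]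
   and containing [A_H] contain [A_K] for all larger [K]; hence the centers form
   a smaller family, and all [A_H] are the same singleton. *)
Lemma hyperconvex_bigcap (C : set (set G)) : C !=set0 -> total_on C subset ->
  (forall H, C H -> hyperconvex H) -> hyperconvex (\bigcap_(H in C) H).
Proof.
move=> [H0 CH0] totC hC S SC Smeet.
(* A family of sets indexed by [C] is coded as a set of pairs, so that minimality is again for
   inclusion. *)
pose fiber (A : set (set G * G)) H := [set x | A (H, x)].
pose Q (A : set (set G * G)) := forall H, C H -> [/\ admissible H (fiber A H), fiber A H !=set0,
  (forall x, A (H, x) -> forall B, S B -> ball B x) &
  forall K, C K -> H `<=` K -> fiber A H `<=` fiber A K].
have [|D D0 DQ totD|A [QA Amin]] := @exists_minimal_set _ Q.
- exists [set p | p.1 p.2 /\ forall B, S B -> ball B p.2] => H CH; split.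
  + by apply: admissible_balls => B /SC; exact.
  + have [|//|x Hx Sx] := hC _ CH S; first by move=> B /SC; exact.
    by exists x.
  + by move=> x [].
  + by move=> K CK HK x [/HK Kx Sx].
- move=> H CH; split.
  + by apply: (@admissible_bigcap _ D (fiber^~ H)) => // A /DQ/(_ _ CH)[].
  + apply: (@chain_admissible_nonempty _ D (fiber^~ H) _ (hC _ CH)).
      by move=> A A' DA DA'; have [h|h] := totD _ _ DA DA'; [left|right] => x /h.
    by move=> A /DQ/(_ _ CH)[].
  + move=> x Dx; have [A DA] := D0.
    by have [_ _ h _] := DQ _ DA _ CH; apply: h; exact: Dx.
  + move=> K CK HK x Dx A DA; have [_ _ _ h] := DQ _ DA _ CH.
    by apply: (h K) => //; exact: Dx.
have mono H K : C H -> C K -> H `<=` K -> fiber A H `<=` fiber A K.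
  by move=> CH CK HK; have [_ _ _ h] := QA _ CH; exact: h.
have star H K x u : C H -> C K -> H `<=` K -> A (H, x) ->
    fiber A H `<=` ball (x, u) -> fiber A K `<=` ball (x, u).
  move=> CH CK HK AHx Hxu.
  (* The ball cuts only the fibers over sets containing [H]: there [x] is an allowed centre, and
     below [H] the fibers lie in the ball already. *)
  pose A' := [set p | A p /\ (H `<=` p.1 -> ball (x, u) p.2)].
  have A'A : A' `<=` A by move=> p [].
  suff : Q A' by move=> /Amin/(_ A'A) AA' y /AA'[_]; apply.
  have A'mono M y : C M -> M `<=` H -> A (M, y) -> ball (x, u) y.
    by move=> CM MH AMy; apply: Hxu; exact: (mono M).
  move=> M CM; have [[AM hM] [y AMy] SM _] := QA _ CM; split.
  + split=> [z /A'A/AM//|z Mz hz]; split=> [|HM].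
      by apply: hM => // B MB AB; apply: hz => // w /A'A/AB.
    apply: hz => [|w [_]]; last exact.
    by apply: HM; have [[h _] _ _ _] := QA _ CH; exact: h.
  + have [HM|MH] := totC _ _ CH CM.
      by exists x; split; [exact: (mono H)|move=> _; exact: Hxu].
    by exists y; split=> // _; exact: A'mono AMy.
  + by move=> z /A'A; exact: SM.
  + move=> N CN MN z [AMz Mz]; split=> [|HN]; first exact: (mono M).
    have [HM|MH] := totC _ _ CH CM; first exact: Mz.
    exact: A'mono AMz.
have [b [l [hbl Qbl]]] := center_radius [set fiber A H | H in C].
pose A' := [set p | center b l (fiber A p.1) p.2].
have A'A : A' `<=` A by move=> [H x] [].
have AA' : A `<=` A'.
  apply: Amin => // H CH; have [Aadm Ane SA _] := QA _ CH; split.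
  - exact: admissible_center.
  - apply: center_nonempty (hC _ CH) _ _ _ => //.
    by apply: hbl; exists H.
  - by move=> x /A'A; exact: SA.
  - move=> K CK HK x [AHx xH]; split=> [|a AKa]; first exact: (mono H).
    rewrite -[b](addbK (odd l)); apply: zigzag_sym.
    apply: (star H K x (b (+) odd l, l)) => // c AHc.
    by apply/zigzag_sym/xH.
have Asub H : C H -> forall x y, A (H, x) -> A (H, y) -> x = y.
  move=> CH x y; apply: (Qbl _ (fiber A H)); last by exists H.
  by move=> _ [K CK <-] a c Aa /AA'[_]; apply.
have [[AH _] [z Az] Sz _] := QA _ CH0.
exists z; last exact: Sz.
move=> K CK; have [[AK _] [y Ay] _ _] := QA _ CK.
have [HK|KH] := totC _ _ CH0 CK; first exact/HK/AH.
by rewrite -(Asub _ CH0 y z) //; [exact: AK|exact: (mono K)].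
Qed.

Lemma hyperconvex_common_fixpoint (F : set (G -> G)) :
  hyperconvex [set: G] -> (forall f, F f -> digraph_endo f) ->
  commuting_set F -> exists x, forall f, F f -> f x = x.
Proof.
move=> hG hF hC.
pose Q H := hyperconvex H /\ forall f, F f -> forall x, H x -> H (f x).
have [|D D0 DQ totD|H [[hH FH] Hmin]] := @exists_minimal_set G Q.
- by exists setT.
- split=> [|f Ff x Dx H DH]; first by apply: hyperconvex_bigcap => // H /DQ[].
  by have [_ h] := DQ _ DH; apply: h => //; exact: Dx.
have [//|//|x Hx _] := hH set0.
exists x => f Ff.
(* By commutation the fixed points of [f] in [H] are invariant under all of [F]. *)
have hfix : H `<=` [set x | H x /\ f x = x].
  apply: Hmin => [|y []//]; split.
    by apply: hyperconvex_fixpoints => //; [exact: hF|exact: FH].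
  by move=> g Fg y [Hy fy]; split; [exact: FH|rewrite hC // fy].
by have [] := hfix _ Hx.
Qed.

End FixedPoints.

(** * Helly property of zigzags and their products *)

(* The minimal right end [r] of a member of the family lies in all of them. *)
Lemma interval_helly (m : nat) (J : Type) (D : set J) (V : J -> set 'I_m.+1) :
  (forall j, D j -> forall p q r : 'I_m.+1, V j p -> V j q -> p <= r <= q -> V j r) ->
  (forall i j, D i -> D j -> V i `&` V j !=set0) ->
  exists r, forall j, D j -> V j r.
Proof.
move=> conv meet.
have [[j0 Dj0]|noD] := pselect (D !=set0); last first.
  by exists ord0 => j Dj; case: noD; exists j.
have exr : exists r, `[< exists2 i, D i & forall p, V i p -> p <= r >].
  by exists m; apply/asboolP; exists j0 => // p _; rewrite -ltnS.
case: (ex_minnP exr) => r /asboolP[i Di ir] rmin.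
have rm : r < m.+1.
  by rewrite ltnS; apply: rmin; apply/asboolP; exists i => // p _; rewrite -ltnS.
exists (Ordinal rm) => j Dj.
have [p [Vip Vjp]] := meet _ _ Di Dj.
have [q Vjq rq] : exists2 q : 'I_m.+1, V j q & r <= q.
  apply: contrapT => noq.
  have jr q : V j q -> q < r.
    by move=> Vjq; rewrite ltnNge; apply/negP => rq; apply: noq; exists q.
  have r0 := leq_ltn_trans (leq0n _) (jr _ Vjp).
  suff /rmin : `[< exists2 i, D i & forall p, V i p -> p <= r.-1 >].
    by rewrite leqNgt prednK // leqnn.
  by apply/asboolP; exists j => // q /jr; rewrite -{1}(prednK r0) ltnS.
by apply: (conv _ Dj p q) => //=; rewrite ir.
Qed.

Section Zigzag.
Variables (G : digraph) (m : nat) (v : 'I_m.+1 -> G).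
Hypothesis Grefl : reflexive_digraph G.
Hypothesis venum : zigzag_enum v.

Lemma arc_enum_near b i j : arc b (v i) (v j) -> i <= j.+1 /\ j <= i.+1.
Proof.
have [_ _ near] := venum.
by case: b => /near[->|e|e]; rewrite ?e; split; lia.
Qed.

(** The last arcs come from positions at most one away from [p] and [q], so an [r] strictly between
    [p] and [q] lies between those positions and induction applies. *)
Lemma zigzag_ball_interval x b k (p q r : 'I_m.+1) :
  zigzag b k x (v p) -> zigzag b k x (v q) -> p <= r <= q -> zigzag b k x (v r).
Proof.
have [[w vK wK] _ _] := venum.
elim: k p q r => [|k IH] p q r.
  move=> /= -> /(can_inj vK) <- prp; congr v; apply: val_inj => /=; lia.
move=> /[dup] xp /zigzagSr[p' xp' p'p] /[dup] xq /zigzagSr[q' xq' q'q] /andP[pr rq].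
rewrite -(wK p') -(wK q') in xp' p'p xq' q'q.
have [pp' _] := arc_enum_near p'p; have [_ qq'] := arc_enum_near q'q.
case: (ltngtP p r) pr => // [pr _|/val_inj <- //].
case: (ltngtP r q) rq => // [rq _|/val_inj -> //].
apply: zigzag_leq (leqnSn k) _ => //.
by apply: (IH (w p') (w q')) => //; lia.
Qed.

(** A step along the enumeration has unknown direction, so it is given two arcs, one of them a loop;
    the even length preserves the direction [true], also under reversal. *)
Lemma zigzag_connected k (x y : G) : m.*2 <= k -> zigzag true k x y.
Proof.
move=> mk; apply: zigzag_leq mk _ => //.
have [[w vK wK] edges _] := venum.
rewrite -(wK x) -(wK y); move: (w x) (w y) => {x y}.
have up d (p q : 'I_m.+1) : q = p + d :> nat -> zigzag true d.*2 (v p) (v q).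
  elim: d p => [|d IH] p pq.
    by rewrite /=; congr v; apply: val_inj; rewrite /= pq addn0.
  have lt_pm : p.+1 < m.+1 by have := ltn_ord q; lia.
  pose p1 := Ordinal lt_pm.
  have /IH p1q : q = p1 + d :> nat by rewrite pq addnS.
  have [[pp1 _]|[p1p _]] := edges p p1 erefl.
    by exists (v p1) => //; exists (v p1) => //; exact: arc_refl.
  by exists (v p); [exact: arc_refl|exists (v p1)].
move=> p q; wlog pq : p q / p <= q => [hw|].
  have [/hw//|/ltnW/hw/zigzag_sym] := leqP p q.
  by rewrite odd_double addbF.
have /up : q = p + (q - p) :> nat by lia.
by apply: zigzag_leq => //; rewrite leq_double; have := ltn_ord q; lia.
Qed.

End Zigzag.

(** All coordinates share one length and one pattern of directions, so walks in the factors are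
    assembled vertex by vertex, by choice. *)
Lemma zigzag_prod (I : Type) (L : I -> digraph) b k (x y : digraph_prod L) :
  zigzag b k x y <-> forall i, zigzag b k (x i) (y i).
Proof.
elim: k b x => [|k IH] b x.
  by split=> [-> //|/= h]; exact: functional_extensionality_dep.
split=> [[z xz /IH zy] i|h].
  by exists (z i) => //; case: b xz {zy}; apply.
have ex i : exists z, arc b (x i) z /\ zigzag (~~ b) k z (y i).
  by have [z] := h i; exists z.
have [z hz] := all_sig (fun i => cid (ex i)).
exists z; last by apply/IH => i; case: (hz i).
by case: b {h ex} hz => hz i; case: (hz i).
Qed.

Lemma hyperconvex_zigzag_prod (I : Type) (L : I -> digraph) :
  (forall i, exists m, reflexive_oriented_zigzag (L i) m) ->
  hyperconvex [set: digraph_prod L].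
Proof.
move=> hL S _ Smeet.
have ex i : exists z : L i, forall B, S B ->
    zigzag B.2.1 B.2.2 (B.1 i) z.
  have [m [Lrefl _ [v venum]]] := hL i.
  have [||r hr] := @interval_helly m _ S
    (fun B => [set j | zigzag B.2.1 B.2.2 (B.1 i) (v j)]).
  - by move=> B _ p q r; exact: zigzag_ball_interval.
  - move=> B C SB SC.
    have [y [/zigzag_prod/(_ i) By /zigzag_prod/(_ i) Cy]] := Smeet _ _ SB SC.
    by have [[w _ wK] _ _] := venum; exists (w (y i)); rewrite /= wK.
  by exists (v r).
have [z hz] := all_sig (fun i => cid (ex i)).
by exists z => // B SB; apply/zigzag_prod => i; exact: hz.
Qed.

(** * Transfer to retracts *)

Theorem theorem5p25 (G : digraph) (I : Type) (L : I -> digraph)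
    (hL : exists n : nat, forall i : I,
            exists2 m : nat, m <= n & reflexive_oriented_zigzag (L i) m)
    (hG : digraph_retract G (digraph_prod L))
    (F : set (G -> G))
    (hF : forall f : G -> G, F f -> digraph_endo f)
    (hC : commuting_set F) :
  exists x : G, forall f : G -> G, F f -> f x = x.
Proof.
have [n hn] := hL; have [s [r [hs hr rs]]] := hG.
(* The conjugates [s \o f \o r] are endomorphisms of the product and commute because [r \o s] is the
   identity. *)
have [||||_ [f Ff <-] x y /hr/(hF _ Ff)/hs//|_ _ [f Ff <-] [g Fg <-] x|x hx] :=
  @hyperconvex_common_fixpoint (digraph_prod L) _ _ _
    [set s \o f \o r | f in F].
- by move=> x i; have [m _ [h _ _]] := hn i; exact: h.
- move=> x y xy yx; apply: functional_extensionality_dep => i.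
  by have [m _ [_ h _]] := hn i; exact: h.
(* The common bound on the lengths gives one walk length for all coordinates. *)
- exists n.*2 => x y; apply/zigzag_prod => i.
  have [m mn [Lrefl _ [v venum]]] := hn i.
  by apply: (zigzag_connected Lrefl venum); rewrite leq_double.
- apply: hyperconvex_zigzag_prod => i.
  by have [m _ h] := hn i; exists m.
- by rewrite /= !rs hC.
exists (r x) => f Ff.
have fx : s (f (r x)) = x by apply: (hx (s \o f \o r)); exists f.
by rewrite -{2}fx rs.
Qed.
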